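(* Let $r=r(n)$ be a function with $r(n)\to\infty$ as $n\to\infty$. Then there is a sequence $\eta(n)\to 0$ (as $n\to\infty$) such that for every $n$ and every $r(n)$-regular graph $\Gamma$ on $n$ vertices, the number of Hamiltonian decompositions of $\Gamma$ is at most $$\left((1+\eta(n))\frac{r}{e^2}\right)^{nr/2},\qquad r=r(n).$$
   Context: Graphs are finite and simple. A Hamilton cycle in a graph $\Gamma$ is a cycle passing through every vertex of $\Gamma$. A Hamiltonian decomposition of $\Gamma$ is a partition of the edge set of $\Gamma$ into (pairwise edge-disjoint) Hamilton cycles; it is an unordered collection of Hamilton cycles. Here $e$ is the base of the natural logarithm. *)

(* Defs.v *)
From mathcomp Require Import all_boot.

Set Implicit Arguments.
Unset Strict Implicit.
Unset Printing Implicit Defensive.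

(* A finite simple graph on V is a symmetric irreflexive relation e : rel V.  *)

Definition edges (V : finType) (e : rel V) : {set {set V}} :=
  [set E : {set V} | [exists x, exists y, e x y && (E == [set x; y])]].

Definition regular_graph (V : finType) (e : rel V) (k : nat) : Prop :=
  forall x : V, #|[set y | e x y]| = k.

Definition cycle_edges (V : finType) (s : seq V) : {set {set V}} :=
  [set [set x; next s x] | x in s].

(* Cycles are identified with their edge sets, so that neither the starting   *)
(* point nor the direction of traversal matters. The bound 2 < #|V| rules out *)
(* the closed walk x, y, x, for which cycle e [:: x; y] holds, and [::].      *)
Definition hamilton_cycle (V : finType) (e : rel V) (C : {set {set V}}) : bool :=
  (2 < #|V|) &&
  [exists s : #|V|.-tuple V,
     [&& ucycleb e s, [forall x, x \in s] & C == cycle_edges s]].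

Definition hamilton_decomposition (V : finType) (e : rel V)
    (D : {set {set {set V}}}) : bool :=
  partition D (edges e) && [forall C in D, hamilton_cycle e C].

Definition num_hamilton_decompositions (V : finType) (e : rel V) : nat :=
  #|[set D : {set {set {set V}}} | hamilton_decomposition e D]|.

(* Main.v *)
(* Removing one Hamilton cycle from a d-regular graph leaves a (d-2)-regular  *)
(* graph, so the number of decompositions is at most the product over even    *)
(* d <= r of the largest number of Hamilton cycles in a d-regular graph. An   *)
(* oriented Hamilton cycle is a permutation supported on the adjacency        *)
(* matrix, so Bregman's theorem bounds that number by (d!)^(n/d), about       *)
(* (d/e)^n. The product of these is about (r!!/e^(r/2))^n, i.e.               *)
(* (r/e^2)^(nr/2). Not dividing by the (r/2)! orderings of the cycles costs   *)
(* only a factor absorbed in eta.                                             *)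

Require Import Defs.
From mathcomp Require Import all_boot all_order all_algebra all_fingroup.
From mathcomp Require Import zify ring lra.
Set Implicit Arguments.
Unset Strict Implicit.
Unset Printing Implicit Defensive.

(** The peeling of cycles rests on [num_hamilton_decompositions_le] and [hamilton_cycle_regular];
    [card_hamilton_cycles] and [bregman] bound the choices at each degree, and
    [num_hamilton_decompositions_regular] multiplies these bounds. For r = 2h and n vertices, the
    logarithm of the count is at most n times the sum over 1 <= k <= h of ln((2k)!)/(2k).

    Each summand is at most ln(2k) - 1 + O(1/sqrt k). Summing ln(2k) = ln 2 + ln k produces ln(h!),
    where Stirling's bound loses another 1 per term, so the sum is at most h (ln r - 2) + O(sqrt h)
    ([sum_avg_log_fact_le]). Thus one factor 1/e comes from Bregman's theorem and the other from the
    product over the degrees. The error is O(1/sqrt r) per cycle, so eta depends on r(n) alone and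
    tends to 0 with 1/r. *)

(** * Permanents of 0/1 matrices and their reduction at one entry *)

Section Permanents.
Variable V : finType.
Implicit Types (A : rel V) (s : {perm V}) (i j k l : V).

Definition row_size A i : nat := #|[set k | A i k]|.

(** The cardinality of this set is the permanent of the 0/1 matrix [A]. *)
Definition matchings A : {set {perm V}} :=
  [set s : {perm V} | [forall i, A i (s i)]].

(* Instead of deleting row [i] and column [k], they are reduced to the single *)
(* entry [(i, k)]; this keeps the index type and the value of the permanent.  *)
Definition pin A i k : rel V :=
  fun j l => if (j == i) || (l == k) then (j == i) && (l == k) else A j l.

(** Rows on which the reduction is finished: pinning at their only entry changes nothing. *)
Definition isolated_entry A i : bool :=
  [exists k, [forall l, A i l == (l == k)] && [forall j, A j k == (j == i)]].

Lemma matchingsP A s : reflect (forall i, A i (s i)) (s \in matchings A).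
Proof. by rewrite inE; apply: forallP. Qed.

Lemma matchings_pin A i k :
  A i k -> matchings (pin A i k) = [set s in matchings A | s i == k].
Proof.
move=> Aik; apply/setP=> s; rewrite [in RHS]inE; apply/matchingsP/andP.
  move=> sP; have /eqP si : s i == k by have:= sP i; rewrite /pin eqxx.
  split; last by rewrite si.
  apply/matchingsP=> j; have := sP j; rewrite /pin.
  case: eqVneq => [-> /= /eqP ->|ji] //=.
  by case: eqVneq.
case=> /matchingsP sP /eqP si j; rewrite /pin -si (inj_eq perm_inj).
by case: eqVneq => //= _; apply: sP.
Qed.

Lemma row_size_pin A i k j : A i k ->
  row_size (pin A i k) j = if j == i then 1 else row_size A j - A j k.
Proof.
move=> Aik; rewrite /row_size; case: (eqVneq j i) => [->|ji].
  rewrite (_ : [set _ | _] = [set k]) ?cards1 //.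
  by apply/setP=> l; rewrite !inE /pin eqxx.
rewrite (cardsD1 k [set l | A j l]) inE addKn; apply: eq_card => l.
by rewrite !inE /pin (negPf ji) /=; case: eqVneq.
Qed.

Lemma row_size_isolated A i : isolated_entry A i -> row_size A i = 1.
Proof.
case/existsP=> k /andP[/forallP Ai _]; rewrite /row_size.
rewrite (_ : [set _ | _] = [set k]) ?cards1 //.
by apply/setP=> l; rewrite !inE (eqP (Ai l)).
Qed.

Lemma isolated_row A s i j :
  s \in matchings A -> isolated_entry A i -> A i (s j) = (j == i).
Proof.
move/matchingsP=> sP /existsP[k /andP[/forallP Ai _]].
by have := sP i; rewrite !(eqP (Ai _)) => /eqP <-; rewrite (inj_eq perm_inj).
Qed.

Lemma isolated_column A s i j :
  s \in matchings A -> isolated_entry A i -> A j (s i) = (j == i).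
Proof.
move/matchingsP=> sP /existsP[k /andP[/forallP Ai /forallP Ak]].
have := sP i; rewrite (eqP (Ai _)) => /eqP ->; exact/eqP.
Qed.

(** The column [s i] of an isolated row [i] meets no other row, so every entry of row [j] lies in a
    column [s i] with [i] not isolated. *)
Lemma card_active_row A s j : s \in matchings A -> ~~ isolated_entry A j ->
  #|[set i | ~~ isolated_entry A i && A j (s i)]| = row_size A j.
Proof.
move=> sM nj; rewrite /row_size -(card_imset _ (@perm_inj _ s)).
apply: eq_card => k; rewrite inE; apply/imsetP/idP.
  by case=> i; rewrite inE => /andP[_ Aji] ->.
move=> Ajk; exists (s^-1%g k); last by rewrite permKV.
rewrite inE permKV Ajk andbT; apply: contra nj => iso.
by have := isolated_column j sM iso; rewrite permKV Ajk => /esym/eqP ->.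
Qed.

(** The measure that makes the induction in [bregman] terminate. *)
Lemma card_pin_lt A i k : A i k -> ~~ isolated_entry A i ->
  #|[set p | pin A i k p.1 p.2]| < #|[set p | A p.1 p.2]|.
Proof.
move=> Aik niso; apply: proper_card; apply/properP; split.
  apply/subsetP=> -[j l]; rewrite !inE /pin /=.
  by case: ifP => // _ /andP[/eqP -> /eqP ->].
move: niso; rewrite negb_exists => /forallP/(_ k).
rewrite negb_and !negb_forall => /orP[/existsP[l]|/existsP[j]] H.
  have lk : l != k by apply: contraNneq H => ->; rewrite Aik eqxx.
  exists (i, l); rewrite !inE /=.
    by move: H; rewrite (negPf lk); case: (A i l).
  by rewrite /pin eqxx (negPf lk).
have ji : j != i by apply: contraNneq H => ->; rewrite Aik eqxx.
exists (j, k); rewrite !inE /=.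
  by move: H; rewrite (negPf ji); case: (A j k).
by rewrite /pin eqxx (negPf ji).
Qed.

Lemma card_matchings_isolated A :
  (forall i, isolated_entry A i) -> #|matchings A| <= 1.
Proof.
move=> iso; apply/card_le1P => s /matchingsP sP t.
rewrite [RHS]inE; apply/idP/eqP => [/matchingsP tP|-> //]; last exact/matchingsP.
apply/permP=> i; case/existsP: (iso i) => k /andP[/forallP Ai _].
move: (sP i) (tP i).
by rewrite !(eqP (Ai _)) => /eqP -> /eqP ->.
Qed.

End Permanents.

(** * Hamilton cycles as permutations, and their removal from a graph *)

Section HamiltonCycles.
Variable V : finType.
Implicit Types (e : rel V) (C : {set {set V}}) (D : {set {set {set V}}}).

Definition delete_edges e C : rel V := fun x y => e x y && ([set x; y] \notin C).

Lemma mem_edges e x y :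
  symmetric e -> ([set x; y] \in edges e) = e x y.
Proof.
move=> e_sym; rewrite inE; apply/existsP/idP=> [[a /existsP[b /andP[eab /eqP E]]]|exy].
  have [xab yab] : x \in [set a; b] /\ y \in [set a; b] by rewrite -E set21 set22.
  have [axy bxy] : a \in [set x; y] /\ b \in [set x; y] by rewrite E set21 set22.
  move: xab yab axy bxy; rewrite !inE.
  move=> /orP[]/eqP? /orP[]/eqP? /orP[]/eqP? /orP[]/eqP?; subst => //.
  by rewrite e_sym.
by exists x; apply/existsP; exists y; rewrite exy eqxx.
Qed.

Lemma delete_edges_sym e C : symmetric e -> symmetric (delete_edges e C).
Proof. by move=> e_sym x y; rewrite /delete_edges e_sym setUC. Qed.

Lemma edges_delete e C :
  symmetric e -> edges (delete_edges e C) = edges e :\: C.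
Proof.
move=> e_sym; apply/setP=> E; rewrite in_setD; apply/idP/andP.
  rewrite inE => /existsP[x /existsP[y /andP[/andP[exy nC] /eqP ->]]].
  by rewrite nC mem_edges.
case=> nC; rewrite inE => /existsP[x /existsP[y /andP[exy /eqP EE]]].
rewrite EE mem_edges; last exact: delete_edges_sym.
by rewrite /delete_edges exy -EE.
Qed.

Lemma set2_inj_r (x y z : V) : [set x; y] = [set x; z] -> y = z.
Proof.
move=> E; have := set22 x z; rewrite -E; have := set22 x y; rewrite {1}E !inE.
by move=> /orP[]/eqP ? /orP[]/eqP ?; congruence.
Qed.

(** The permutation is the successor map of an orientation of the cycle. Its last property makes the
    two neighbours of [x] on the cycle distinct, so that removing the cycle lowers degrees by
    exactly 2. *)
Lemma hamilton_cycle_perm e C : symmetric e -> hamilton_cycle e C ->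
  exists s : {perm V}, [/\ s \in matchings e, C = [set [set x; s x] | x in V]
    & forall x, s x != s^-1%g x].
Proof.
move=> e_sym /andP[V3 /existsP[t /and3P[/andP[cyc uniq_t] /forallP tV /eqP ->]]].
have next_inj : injective (next t) := can_inj (prev_next uniq_t).
pose s := perm next_inj; exists s.
have sE x : s x = next t x by rewrite permE.
have ts : cycle_edges t = [set [set x; s x] | x in V].
  by apply/setP => E; apply/imsetP/imsetP => -[x _ ->]; exists x; rewrite ?sE.
split=> //.
  by apply/matchingsP=> x; rewrite sE; apply: next_cycle.
move=> x; apply/eqP => sx.
have ssx : s (s x) = x by rewrite {1}sx permKV.
have [i y E] := rot_to (tV x).
have uy : uniq (x :: y) by rewrite -E rot_uniq.
have sizey : size (x :: y) = #|V| by rewrite -E size_rot size_tuple.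
have sE' z : s z = next (x :: y) z by rewrite sE -E next_rot.
clear -V3 uy sizey sE' ssx.
(* Lengths 1 and 2 contradict [2 < #|V|]; otherwise two steps lead from [x] to [b], which differs
   from [x]. *)
case: y uy sizey sE' ssx => [|a [|b y]] /= uy sizey sE' ssx.
- by rewrite -sizey in V3.
- by rewrite -sizey in V3.
move: ssx; rewrite !sE' /= eqxx; move: uy.
rewrite !inE !negb_or => /andP[/andP[xa /andP[xb _]] /andP[/andP[ab _] _]].
rewrite eq_sym (negPf xa) eqxx => /eqP; by rewrite eq_sym (negPf xb).
Qed.

Lemma hamilton_cycle_regular e C (d : nat) :
  symmetric e -> hamilton_cycle e C -> regular_graph e d ->
  1 < d /\ regular_graph (delete_edges e C) (d - 2).
Proof.
move=> e_sym hC ed.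
have [s [/matchingsP sM CE snV]] := hamilton_cycle_perm e_sym hC.
have memC x y : ([set x; y] \in C) = (y \in [set s x; s^-1%g x]).
  rewrite CE; apply/imsetP/idP => [[z _ E]|].
    have := set21 x y; rewrite E !inE => /orP[]/eqP xz.
      by rewrite xz in E *; rewrite (set2_inj_r E) eqxx.
    move: E; rewrite -xz setUC => /esym; rewrite setUC [in RHS]setUC.
    by move/set2_inj_r => <-; rewrite xz permK eqxx orbT.
  rewrite !inE => /orP[]/eqP ->; first by exists x.
  by exists (s^-1%g x); rewrite ?permKV // setUC.
have sub x : [set s x; s^-1%g x] \subset [set y | e x y].
  apply/subsetP=> y; rewrite !inE => /orP[]/eqP -> //.
  by rewrite e_sym -{2}(permKV s x).
have card2 x : #|[set s x; s^-1%g x]| = 2 by rewrite cards2 snV.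
split.
  case/andP: hC => V3 _; have /card_gt0P[x _] : 0 < #|V| by lia.
  by rewrite -(ed x) -(card2 x) subset_leq_card.
move=> x; rewrite -(ed x) -(card2 x) -(setIidPr (sub x)) -cardsD.
by apply: eq_card => y; rewrite !inE /delete_edges memC !inE andbC.
Qed.

Definition hamilton_cycles e : {set {set {set V}}} :=
  [set C | hamilton_cycle e C].

Lemma card_hamilton_cycles e :
  symmetric e -> #|hamilton_cycles e| <= #|matchings e|.
Proof.
move=> e_sym.
apply: leq_trans (leq_imset_card (fun s : {perm V} => [set [set x; s x] | x in V]) _).
apply/subset_leq_card/subsetP=> C; rewrite inE => /(hamilton_cycle_perm e_sym).
by case=> s [sM -> _]; apply/imsetP; exists s.
Qed.

(** Choose one cycle in each decomposition. Among decompositions with the same chosen cycle [C],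
    removing [C] is injective and leaves a decomposition of the remaining graph. *)
Lemma num_hamilton_decompositions_le e : symmetric e -> edges e != set0 ->
  num_hamilton_decompositions e <=
    \sum_(C in hamilton_cycles e) num_hamilton_decompositions (delete_edges e C).
Proof.
move=> e_sym e0; pose S := [set D | hamilton_decomposition e D].
(* The default is never reached on [S]: a decomposition of a nonempty edge set has a member. *)
pose c D := odflt set0 [pick C in D].
have cP D : D \in S -> c D \in D.
  rewrite inE /c => /andP[Dp _]; case: pickP => //= D0.
  have D00 : D = set0 by apply/setP=> C; rewrite inE; apply: D0.
  by move: e0; rewrite -(cover_partition Dp) D00 /cover big_set0 eqxx.
have cH D : D \in S -> c D \in hamilton_cycles e.
  move=> DS; rewrite inE; have := cP D DS.
  by move: DS; rewrite inE => /andP[_ /'forall_implyP]; apply.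
rewrite /num_hamilton_decompositions -/S -sum1_card.
rewrite (partition_big c (mem (hamilton_cycles e))) //=.
apply: leq_sum => C CH; rewrite sum1dep_card.
rewrite -(@card_in_imset _ _ (fun D => D :\ C)); last first.
  move=> D1 D2; rewrite !inE => /andP[D1S /eqP c1] /andP[D2S /eqP c2] E.
  rewrite -(@setD1K _ C D1) -1?(@setD1K _ C D2) ?E //.
    by rewrite -c2; apply: cP; rewrite inE.
  by rewrite -c1; apply: cP; rewrite inE.
apply/subset_leq_card/subsetP => D' /imsetP[D]; rewrite inE => /andP[DS /eqP cD] ->.
have CD : C \in D by rewrite -cD cP.
move: DS; rewrite !inE => /andP[Dp /'forall_implyP DH].
rewrite /hamilton_decomposition edges_delete // partitionD1 //=.
apply/'forall_implyP => C'; rewrite !inE => /andP[C'C C'D].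
have /andP[V3 /existsP[t /and3P[/andP[cyc ut] tV /eqP E]]] := DH _ C'D.
rewrite /hamilton_cycle V3; apply/existsP; exists t.
rewrite tV /ucycleb ut E eqxx !andbT.
apply: cycle_from_next => // x xt; rewrite /delete_edges next_cycle //=.
have Et : [set x; next t x] \in C' by rewrite E; apply: imset_f.
have /trivIsetP triv := partition_trivIset Dp.
have /disjointFr := triv _ _ C'D CD C'C.
by move=> /(_ _ Et) ->.
Qed.

Lemma num_hamilton_decompositions0 e :
  edges e = set0 -> num_hamilton_decompositions e <= 1.
Proof.
move=> e0; rewrite -(cards1 (set0 : {set {set {set V}}})); apply: subset_leq_card.
by apply/subsetP=> D; rewrite !inE /hamilton_decomposition e0 partition_set0 => /andP[].
Qed.

Lemma edges_neq0 e (d : nat) :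
  0 < d -> 0 < #|V| -> regular_graph e d -> edges e != set0.
Proof.
move=> d0 /card_gt0P[x _] /(_ x) ex.
have /card_gt0P[y] : 0 < #|[set y | e x y]| by rewrite ex.
rewrite inE => exy; apply/set0Pn; exists [set x; y]; rewrite inE.
by apply/existsP; exists x; apply/existsP; exists y; rewrite exy eqxx.
Qed.

End HamiltonCycles.

From mathcomp Require Import all_classical all_reals all_analysis.
Import Order.TTheory GRing.Theory Num.Theory.
Import numFieldNormedType.Exports.
Local Open Scope ring_scope.

(** * Bregman's theorem in logarithmic form *)

Section Bregman.
Variable R : realType.

Definition log_fact (m : nat) : R := ln (m`!%:R).

(** The logarithm of Bregman's row factor (m!)^(1/m). *)
Definition avg_log_fact (m : nat) : R := log_fact m / m%:R.

Lemma log_factS m : log_fact m.+1 = ln (m.+1%:R) + log_fact m.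
Proof. by rewrite /log_fact factS natrM lnM // posrE ltr0n // fact_gt0. Qed.

Lemma avg_log_fact1 : avg_log_fact 1 = 0.
Proof. by rewrite /avg_log_fact /log_fact ln1 mul0r. Qed.

Lemma avg_log_factMn m : avg_log_fact m *+ m = log_fact m.
Proof.
case: m => [|m]; first by rewrite /log_fact ln1.
by rewrite -[LHS]mulr_natr /avg_log_fact divfK // pnatr_eq0.
Qed.

Lemma ln_ge_1_sub_inv (x : R) : 0 < x -> 1 - x^-1 <= ln x.
Proof.
move=> x0; have := @le_ln1Dx R (x^-1 - 1).
rewrite subrKC lnV ?posrE // => H.
rewrite -lerN2 opprB; apply: H; rewrite ltrBrDr addNr; by rewrite invr_gt0.
Qed.

Variable V : finType.
Implicit Types (A : rel V) (i j k : V).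

(* Jensen for x ln x, applied to the numbers of matchings with a given image  *)
(* of [i]; it is derived from ln y >= 1 - 1/y.                                *)
Lemma card_matchings_xlnx_le A i : (0 < #|matchings A|)%N ->
  #|matchings A|%:R * ln (#|matchings A|%:R : R) <=
    \sum_(s in matchings A)
      (ln (row_size A i)%:R + ln (#|matchings (pin A i (s i))|%:R)).
Proof.
set S := matchings A; set P : R := #|S|%:R => S0.
have P0 : 0 < P by rewrite ltr0n.
have sA s : s \in S -> A i (s i) by move/matchingsP.
have pinE k : A i k -> #|matchings (pin A i k)| = #|[set s in S | s i == k]|.
  by move=> Aik; rewrite matchings_pin.
have pin0 s : s \in S -> (0 : R) < #|matchings (pin A i (s i))|%:R.
  move=> sS; rewrite ltr0n pinE ?sA //; apply/card_gt0P; exists s.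
  by rewrite inE sS eqxx.
have r0 : (0 : R) < (row_size A i)%:R.
  case/card_gt0P: S0 => s sS; rewrite ltr0n; apply/card_gt0P; exists (s i).
  by rewrite inE sA.
(* Grouped by [k = s i], the equal terms of a nonempty class add up to 1, and there are at most
   [row_size A i] classes. *)
have inv_sum : \sum_(s in S) (#|matchings (pin A i (s i))|%:R)^-1 <= (row_size A i)%:R :> R.
  rewrite (partition_big (fun s : {perm V} => s i) (fun k => A i k)) /=; last first.
    by move=> s sS; apply: sA.
  rewrite /row_size -sum1_card natr_sum.
  rewrite [in leRHS](eq_bigl (A i)); last by move=> k; rewrite inE.
  apply: ler_sum => k Aik.
  rewrite (eq_bigr (fun=> (#|matchings (pin A i k)|%:R)^-1)); last first.
    by move=> s /andP[_ /eqP ->].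
  rewrite (eq_bigl (mem [set s in S | s i == k])); last by move=> s; rewrite [RHS]inE.
  rewrite sumr_const -pinE // -[_^-1 *+ _]mulr_natr.
  have [->|n0] := eqVneq (#|matchings (pin A i k)|%:R : R) 0; first by rewrite mulr0.
  by rewrite mulVf.
rewrite -subr_ge0.
have -> : P * ln P = \sum_(s in S) ln P by rewrite sumr_const -[RHS]mulr_natl.
rewrite -sumrB.
apply: (@le_trans _ _ (\sum_(s in S)
    (1 - P / (row_size A i)%:R * (#|matchings (pin A i (s i))|%:R)^-1))).
  rewrite sumrB -mulr_sumr sumr_const -/P subr_ge0.
  rewrite mulrAC ler_pdivrMr // ler_wpM2l // ltW //.
apply: ler_sum => s sS.
rewrite -lnM ?posrE ?pin0 // -ln_div ?posrE ?mulr_gt0 ?pin0 //.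
apply: le_trans (ln_ge_1_sub_inv _); last by rewrite divr_gt0 ?mulr_gt0 ?pin0.
by rewrite invf_div invfM mulrA.
Qed.

(** Fix a non-isolated row [j] of size r. Pinning row [j] itself gives ln r; r - 1 other pinnings
    shrink row [j] to size r - 1 and together give ln((r-1)!); the rest leave its size r. The first
    two parts add up to ln(r!), which is r times the average, so each pinning contributes the
    average for r in the mean. *)
Lemma sum_pin_avg_log_fact A s : s \in matchings A ->
  \sum_(i | ~~ isolated_entry A i) (ln (row_size A i)%:R
     + \sum_j avg_log_fact (row_size (pin A i (s i)) j))
  = (\sum_j avg_log_fact (row_size A j)) *+ #|[set i | ~~ isolated_entry A i]|.
Proof.
move=> sS; have /matchingsP sA := sS.
rewrite big_split /= exchange_big /= -sumrMnl.
rewrite [X in _ + X](bigID (fun j => isolated_entry A j)) /=.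
rewrite [RHS](bigID (fun j => isolated_entry A j)) /=.
rewrite [X in _ + (X + _)]big1 ?add0r; last first.
  move=> j isoj; apply: big1 => i isoi; rewrite row_size_pin //.
  rewrite (row_size_isolated isoj).
  case: eqVneq => [|ji]; first by rewrite avg_log_fact1.
  by rewrite isolated_row // eq_sym (negPf ji) avg_log_fact1.
rewrite [X in _ = X + _]big1 ?add0r; last first.
  by move=> j isoj; rewrite row_size_isolated // avg_log_fact1 mul0rn.
rewrite -big_split /=; apply: eq_bigr => j nj.
pose r := row_size A j; pose K := [set i | ~~ isolated_entry A i && A j (s i)].
have Kr : #|K| = r := card_active_row sS nj.
have jK : j \in K by rewrite inE nj sA.
rewrite (bigID (fun i => A j (s i))) /= (bigD1 j) /=; last by rewrite nj sA.
rewrite {1}row_size_pin // eqxx avg_log_fact1 add0r.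
rewrite (eq_bigr (fun=> avg_log_fact r.-1)); last first.
  by move=> i /andP[/andP[_ Aji] ij]; rewrite row_size_pin // eq_sym (negPf ij) Aji subn1.
rewrite [X in _ + (_ + X)](eq_bigr (fun=> avg_log_fact r)); last first.
  move=> i /andP[_ nA]; rewrite row_size_pin // (negPf nA) subn0.
  by case: eqVneq nA => // ->; rewrite sA.
rewrite (eq_bigl (mem (K :\ j))); last by move=> i; rewrite !inE andbC.
rewrite [X in _ + (_ + X)](eq_bigl (mem ([set i | ~~ isolated_entry A i] :\: K))); last first.
  by move=> i; rewrite !inE; case: (isolated_entry A i); rewrite ?andbF ?andbT.
rewrite !sumr_const.
have -> : #|K :\ j| = r.-1 by rewrite -Kr (cardsD1 j K) jK.
rewrite avg_log_factMn addrA.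
have -> : ln r%:R + log_fact r.-1 = avg_log_fact r *+ r.
  have : (0 < r)%N by rewrite -Kr; apply/card_gt0P; exists j.
  by rewrite avg_log_factMn; case: r {Kr} => // q _; rewrite log_factS.
rewrite -mulrnDr -Kr; congr (_ *+ _); first by rewrite Kr.
rewrite -(cardsID K [set i | ~~ isolated_entry A i]); congr (_ + _)%N.
by apply: eq_card => i; rewrite !inE andbA andbb.
Qed.

(* Schrijver's proof of the Minc conjecture, by induction on the number of    *)
(* nonzero entries. The average runs over the rows whose pinning removes some *)
(* entry; including the others would make the induction circular.             *)
Lemma bregman A : (0 < #|matchings A|)%N ->
  ln (#|matchings A|%:R : R) <= \sum_i avg_log_fact (row_size A i).
Proof.
have [m] := ubnP #|[set p | A p.1 p.2]|; elim: m A => // m IHm A lem S0.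
set S := matchings A in S0 *.
have [i /negPf ni|iso] := pickP (fun i => ~~ isolated_entry A i); last first.
  have /eqP -> : #|S| == 1%N.
    rewrite eqn_leq S0 andbT card_matchings_isolated // => i.
    exact/negbFE/iso.
  rewrite ln1 big1 // => i _.
  by rewrite row_size_isolated ?avg_log_fact1 //; exact/negbFE/iso.
set I := [set i | ~~ isolated_entry A i].
have I0 : (0 : R) < #|I|%:R by rewrite ltr0n; apply/card_gt0P; exists i; rewrite inE ni.
have P0 : (0 : R) < #|S|%:R by rewrite ltr0n.
rewrite -(ler_pM2l I0) -(ler_pM2l P0).
apply: (@le_trans _ _ (\sum_(i | ~~ isolated_entry A i) \sum_(s in S)
    (ln (row_size A i)%:R + ln (#|matchings (pin A i (s i))|%:R)))).
  rewrite mulrCA mulr_natl -sumr_const (eq_bigl (fun i => ~~ isolated_entry A i)).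
    by apply: ler_sum => j _; apply: card_matchings_xlnx_le.
  by move=> j; rewrite inE.
rewrite exchange_big /= mulr_natl -sumr_const; apply: ler_sum => s sS.
rewrite mulr_natl -(sum_pin_avg_log_fact sS); apply: ler_sum => j nj.
have Ajs : A j (s j) by move/matchingsP: sS.
rewrite lerD2l; apply: IHm.
  by have := card_pin_lt Ajs nj; rewrite ltnS in lem; move/leq_trans; apply.
by rewrite matchings_pin //; apply/card_gt0P; exists s; rewrite inE sS eqxx.
Qed.

End Bregman.

(** * Explicit Stirling-type estimates *)

Section Asymptotics.
Variable R : realType.
Local Notation log_fact := (log_fact R).
Local Notation avg_log_fact := (avg_log_fact R).

(** This is m! <= e m (m/e)^m; the induction step amounts to (x + 1) ln((x + 1)/x) >= 1. *)
Lemma log_fact_le m : (0 < m)%N ->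
  log_fact m <= m%:R * ln m%:R - m%:R + ln m%:R + 1.
Proof.
elim: m => // -[_ _|m IHm _].
  by rewrite /log_fact ln1 mulr0 addr0 add0r addNr.
rewrite log_factS; set x : R := m.+1%:R in IHm *.
have x0 : 0 < x by rewrite ltr0n.
have x1 : 0 < x + 1 by rewrite addr_gt0.
have -> : m.+2%:R = x + 1 by rewrite -natr1.
have := @ln_ge_1_sub_inv R ((x + 1) / x); rewrite divr_gt0 //.
rewrite ln_div ?posrE // invf_div => /(_ isT).
have -> : 1 - x / (x + 1) = (x + 1)^-1 by field; rewrite gt_eqF.
rewrite -(ler_pM2l x1) divff ?gt_eqF //.
have := IHm isT; nra.
Qed.

Lemma ln_le_sqrt (x : R) : 0 < x -> ln x + 1 <= 2 * Num.sqrt x.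
Proof.
move=> x0; have s0 : 0 < Num.sqrt x by rewrite sqrtr_gt0.
rewrite -{1}(sqr_sqrtr (ltW x0)) lnXn // mulr2n.
have := @le_ln1Dx R (Num.sqrt x - 1); rewrite subrKC ltrBrDr addNr => /(_ s0); lra.
Qed.

(** Telescoping: 1/a <= 2 (a - b) when a^2 = b^2 + 1, because (a - b)^2 >= 0. *)
Lemma sum_inv_sqrt_le h :
  \sum_(k < h) (Num.sqrt k.+1%:R)^-1 <= 2 * Num.sqrt h%:R :> R.
Proof.
elim: h => [|h IHh]; first by rewrite big_ord0 sqrtr0 mulr0.
rewrite big_ord_recr /=; apply: le_trans (lerD IHh (lexx _)) _.
set a := Num.sqrt h.+1%:R; set b := Num.sqrt h%:R.
have a0 : 0 < a by rewrite sqrtr_gt0 ltr0n.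
rewrite -lerBrDl -(ler_pM2r a0) mulVf ?gt_eqF //.
have : a ^+ 2 = b ^+ 2 + 1 by rewrite !sqr_sqrtr ?ler0n // natr1.
have := sqr_ge0 (a - b); nra.
Qed.

Lemma avg_log_fact_le m : (0 < m)%N ->
  avg_log_fact m <= ln m%:R - 1 + 2 / Num.sqrt m%:R.
Proof.
move=> m0; have m0R : (0 : R) < m%:R by rewrite ltr0n.
have s0 : (0 : R) < Num.sqrt m%:R by rewrite sqrtr_gt0.
rewrite /avg_log_fact ler_pdivrMr //; apply: le_trans (log_fact_le m0) _.
have := ln_le_sqrt m0R.
have -> : (ln m%:R - 1 + 2 / Num.sqrt m%:R) * m%:R
   = m%:R * ln m%:R - m%:R + 2 * Num.sqrt m%:R :> R.
  rewrite -{3 5}(sqr_sqrtr (ltW m0R)); set s := Num.sqrt _ in s0 *.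
  rewrite -(sqr_sqrtr (ltW m0R)) -/s; field.
  by rewrite gt_eqF.
lra.
Qed.

(** The 6 is 4 + 2: twice the sum of 1/sqrt k gives 4 sqrt h, and the term ln h + 1 in the bound on
    ln(h!) is at most 2 sqrt h. *)
Lemma sum_avg_log_fact_le h : (0 < h)%N ->
  \sum_(k < h) avg_log_fact k.+1.*2 <=
    h%:R * (6 / Num.sqrt h%:R + ln h.*2%:R - 2).
Proof.
move=> h0; have h0R : (0 : R) < h%:R by rewrite ltr0n.
have s0 : (0 : R) < Num.sqrt h%:R by rewrite sqrtr_gt0.
apply: (@le_trans _ _ (\sum_(k < h)
    (ln 2 - 1 + ln k.+1%:R + 2 * (Num.sqrt k.+1%:R)^-1))).
  apply: ler_sum => k _; apply: le_trans (avg_log_fact_le _) _ => //.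
  rewrite -mul2n natrM lnM ?posrE ?ltr0n // lerD //; first by lra.
  rewrite ler_pM2l // lef_pV2 ?posrE ?sqrtr_gt0 ?mulr_gt0 ?ltr0n //.
  by rewrite ler_wsqrtr // ler_peMl ?ler0n // ler1n.
have ln_fact : \sum_(k < h) ln (k.+1%:R : R) = log_fact h.
  elim: h {h0 h0R s0} => [|h IHh]; first by rewrite big_ord0 /log_fact ln1.
  by rewrite big_ord_recr /= IHh addrC -log_factS.
rewrite 2!big_split /= ln_fact -mulr_sumr sumr_const card_ord.
rewrite -[(ln 2 - 1) *+ h]mulr_natl.
have H1 := log_fact_le h0; have H2 := ln_le_sqrt h0R; have H3 := sum_inv_sqrt_le h.
have -> : ln h.*2%:R = ln 2 + ln h%:R :> R.
  by rewrite -mul2n natrM lnM ?posrE ?ltr0n.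
have -> : h%:R * (6 / Num.sqrt h%:R + (ln 2 + ln h%:R) - 2)
   = 6 * Num.sqrt h%:R + h%:R * (ln 2 + ln h%:R) - h%:R * 2 :> R.
  rewrite mulrBr mulrDr; congr (_ + _ - _).
  by rewrite mulrCA -{1}(sqr_sqrtr (ltW h0R)) expr2 mulfK ?gt_eqF.
lra.
Qed.

End Asymptotics.

(** * The product bound for regular graphs *)

Section Counting.
Variables (R : realType) (V : finType).
Implicit Types (e : rel V).
Local Notation avg_log_fact := (avg_log_fact R).

Lemma card_matchings_regular e d : regular_graph e d ->
  #|matchings e|%:R <= expR (#|V|%:R * avg_log_fact d).
Proof.
move=> ed; have [->|P0] := posnP #|matchings e|; first exact: expR_ge0.
rewrite -[leLHS]lnK ?posrE ?ltr0n // ler_expR; apply: le_trans (bregman _ P0) _.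
rewrite (eq_bigr (fun=> avg_log_fact d)); last by move=> i _; rewrite /row_size ed.
by rewrite sumr_const mulr_natl.
Qed.

(** The degrees met while peeling are d, d - 2, ..., 2, hence the arguments [k.+1.*2]. An odd degree
    ends at 1, where no Hamilton cycle is left, hence the value 0. *)
Lemma num_hamilton_decompositions_regular e d :
  (0 < #|V|)%N -> symmetric e -> regular_graph e d ->
  (num_hamilton_decompositions e)%:R <=
    if odd d then 0 else expR (#|V|%:R * \sum_(k < d./2) avg_log_fact k.+1.*2).
Proof.
move=> V0; have [m] := ubnP d; elim: m d e => // m IHm d e dm e_sym ed.
have [d0|d0] := posnP d.
  rewrite d0 /= big_ord0 mulr0 expR0 lern1 num_hamilton_decompositions0 //.
  apply/setP=> E; rewrite !inE; apply/negbTE/negP.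
  case/existsP=> x /existsP[y /andP[exy _]].
  by have := card0_eq (etrans (ed x) d0) y; rewrite !inE exy.
have := num_hamilton_decompositions_le e_sym (edges_neq0 d0 V0 ed).
rewrite -(ler_nat R) natr_sum => /le_trans; apply.
set B := fun d : nat => if odd d then 0
  else expR (#|V|%:R * \sum_(k < d./2) avg_log_fact k.+1.*2).
apply: (@le_trans _ _ (\sum_(C in hamilton_cycles e) B (d - 2)%N)).
  apply: ler_sum => C; rewrite inE => hC.
  have [d1 eCd] := hamilton_cycle_regular e_sym hC ed.
  apply: IHm => //; [by lia | exact: delete_edges_sym].
rewrite sumr_const.
(* For [d = 1] the truncated [d - 2] is 0, an even degree, but then there is no cycle and the sum is
   empty. *)
have [->|[C]] := set_0Vmem (hamilton_cycles e).
  by rewrite cards0 mulr0n; case: ifP => // _; apply: expR_ge0.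
rewrite inE => hC; have [d1 _] := hamilton_cycle_regular e_sym hC ed.
case: d d1 ed {IHm dm d0} => [|[|d]] // _ ed; rewrite !subSS subn0 /B /= negbK.
case: ifP => dodd; first by rewrite mul0rn.
rewrite big_ord_recr /= mulrDr expRD -[leLHS]mulr_natr ler_wpM2l ?expR_ge0 //.
have -> : d./2.+1.*2 = d.+2 by lia.
apply: le_trans (card_matchings_regular ed).
by rewrite ler_nat card_hamilton_cycles.
Qed.

End Counting.

(** * The error term and the conclusion *)

Local Open Scope classical_set_scope.

Lemma cvg_error_term (R : realType) :
  expR (6 * Num.sqrt (2 * m%:R^-1)) - 1 @[m --> \oo] --> (0 : R).
Proof.
have inv0 : (m%:R^-1 : R) @[m --> \oo] --> (0 : R).
  apply/gtr0_cvgV0; last exact: cvgr_idn.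
  by exists 1%N => // m /= m0; rewrite ltr0n.
have sqrt0 : (6 * Num.sqrt (2 * m%:R^-1) : R) @[m --> \oo] --> (0 : R).
  rewrite -[X in _ --> X](mulr0 6); apply: cvgM; first exact: cvg_cst.
  rewrite -[X in _ --> X]sqrtr0; apply: continuous_cvg; first exact: sqrt_continuous.
  by rewrite -[X in _ --> X](mulr0 2); apply: cvgM => //; exact: cvg_cst.
rewrite -[X in _ --> X](subrr 1); apply: cvgB; last exact: cvg_cst.
rewrite -[X in _ --> X](expR0 R); apply: continuous_cvg => //.
exact: continuous_expR.
Qed.

Theorem proposition1p1 (R : realType) (r : nat -> nat)
    (r_oo : r n @[n --> \oo] --> \oo) :
  exists2 eta : nat -> R, eta n @[n --> \oo] --> (0 : R) &
    forall (n : nat) (V : finType) (e : rel V),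
      #|V| = n -> symmetric e -> irreflexive e ->
      regular_graph e (r n) ->
      (num_hamilton_decompositions e)%:R
        <= ((1 + eta n) * ((r n)%:R / expR 1 ^+ 2)) `^ ((n * r n)%:R / 2).
Proof.
(* Chosen so that, for r = 2h > 0, ln(1 + eta) is exactly the error 6 / sqrt h of
   [sum_avg_log_fact_le]. *)
exists (fun n => expR (6 * Num.sqrt (2 * (r n)%:R^-1)) - 1).
  exact: (cvg_comp _ _ r_oo (@cvg_error_term R)).
move=> n V e Vn e_sym _ ed; rewrite addrCA subrr addr0.
have [n0|n0] := posnP n.
  rewrite n0 mul0n mul0r powRr0 lern1 num_hamilton_decompositions0 //.
  apply/setP=> E; rewrite !inE; apply/negbTE/negP => /existsP[x _].
  by have /card0_eq/(_ x) := etrans Vn n0.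
move: (r n) ed => d ed; rewrite -Vn in n0 *.
apply: le_trans (num_hamilton_decompositions_regular R n0 e_sym ed) _.
case: ifPn => [_|d_even]; first exact: powR_ge0.
have [->|d0] := posnP d.
  by rewrite big_ord0 muln0 !mul0r powRr0 mulr0 expR0.
have dE : d = d./2.*2 by lia.
move: (d./2) dE d0 => h -> {d ed d_even}; rewrite double_gt0 => h0.
have d0 : (0 : R) < h.*2%:R by rewrite ltr0n double_gt0.
have e2 : (0 : R) < expR 1 ^+ 2 by rewrite exprn_gt0 ?expR_gt0.
rewrite /powR gt_eqF; last by rewrite mulr_gt0 ?divr_gt0 ?expR_gt0.
rewrite ler_expR lnM ?posrE ?divr_gt0 ?expR_gt0 // ln_div ?posrE //.
rewrite lnXn ?expR_gt0 // !expRK addrA.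
have -> : (#|V| * h.*2)%:R / 2 = #|V|%:R * h%:R :> R.
  by rewrite -muln2 mulnA !natrM mulfK ?pnatr_eq0.
rewrite -mulrA ler_wpM2l //; apply: le_trans (sum_avg_log_fact_le R h0) _.
rewrite -muln2 natrM invfM mulrCA divff ?pnatr_eq0 // mulr1 sqrtrV ?ler0n //.
Qed.
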